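(* Consider $L$ parallel queues under JSQ routing (setting in the context), serving the exogenous arrival process $\{A_\Sigma^{(\epsilon)}[t]\}_t$ with mean $\lambda_\Sigma^{(\epsilon)}$, parameterized by $\epsilon=\mu_\Sigma-\lambda_\Sigma^{(\epsilon)}>0$, and let $\overline{\mathbf Q}^{(\epsilon)}$ be the limiting steady-state queue-length vector. Let $$\overline{\mathbf Q}_\perp^{(\epsilon)}=\Big(\bar Q_l^{(\epsilon)}-\tfrac1L\sum_{m=1}^L\bar Q_m^{(\epsilon)}\Big)_{l=1}^L .$$ Then for any $\delta\in(0,\mu_{\min})$, where $\mu_{\min}=\min_l\mu_l$, there exists a sequence of finite numbers $\{N_r\}_{r=1,2,\dots}$ such that $\mathbb E\big[\|\overline{\mathbf Q}_\perp^{(\epsilon)}\|^r\big]\le N_r$ for all $\epsilon\in(0,(\mu_{\min}-\delta)L)$ and each $r=1,2,\dots$.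
   Context: Routing model. There are $L$ queues in slotted time $t=0,1,2,\dots$ with nonnegative-integer lengths $\mathbf Q[t]=(Q_l[t])_{l=1}^L$ evolving as $Q_l[t+1]=(Q_l[t]+A_l[t]-S_l[t])^+$. In each slot a random number $A_\Sigma^{(\epsilon)}[t]$ of exogenous packets arrives at a router, which chooses a nonnegative integer vector $\mathbf A[t]$ with $\sum_l A_l[t]=A^{(\epsilon)}_\Sigma[t]$. The exogenous arrival process and the service processes $\{S_l[t]\}_t$, $l=1,\dots,L$, are mutually independent; each is i.i.d. over time, nonnegative-integer valued and bounded: $A^{(\epsilon)}_\Sigma[t]\le A_{\max}<\infty$, $S_l[t]\le S_{\max}<\infty$, with $A_{\max},S_{\max}$ and the service processes not depending on $\epsilon$. Notation: $\mu_l=\mathbb E[S_l[1]]$, $\mu_\Sigma=\sum_l\mu_l$, $\min_l\mu_l>0$; $\|\cdot\|$ is the Euclidean norm. JSQ: in every slot all incoming packets are sent to one of the queues of smallest length $Q_l[t]$, ties broken uniformly at random. Steady state: under JSQ with $\lambda^{(\epsilon)}_\Sigma<\mu_\Sigma$, the Markov chain $\{\mathbf Q^{(\epsilon)}[t]\}_t$ converges in distribution to a random vector $\overline{\mathbf Q}^{(\epsilon)}$ (its steady state), all of whose moments are finite; this fact is taken as part of the setting. *)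

(* Defs.v *)
From HB Require Import structures.
From mathcomp Require Export all_boot all_order all_algebra finmap.
From mathcomp Require Export all_classical all_reals all_analysis.

Set Implicit Arguments.
Unset Strict Implicit.
Unset Printing Implicit Defensive.

Export Order.TTheory GRing.Theory Num.Theory.
Export numFieldNormedType.Exports.

Global Open Scope classical_set_scope.
Global Open Scope ring_scope.

(* Vectors of L nonnegative integers, with the discrete sigma-algebra. *)
Definition qvec (L : nat) : Type := {ffun 'I_L -> nat}.

HB.instance Definition _ (L : nat) := Choice.on (qvec L).
HB.instance Definition _ (L : nat) :=
  isPointed.Build (qvec L) [ffun _ : 'I_L => 0%N].
HB.instance Definition _ (L : nat) :=
  @isMeasurable.Build default_measure_display (qvec L)
    discrete_measurable discrete_measurable0
    (@discrete_measurableC (qvec L)) (@discrete_measurableU (qvec L)).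

Definition qval (L : nat) (q : qvec L) (l : 'I_L) : nat :=
  (q : {ffun 'I_L -> nat}) l.

Section Independence.
Context (R : realType) (d : measure_display) (T : measurableType d).
Variable P : probability T R.

Definition mutually_independent (I : choiceType) (F : I -> set_system T) :=
  forall (J : {fset I}) (B : I -> set T), (forall i, i \in J -> F i (B i)) ->
    P (\bigcap_(i in [set` J]) B i) = (\prod_(i <- J) P (B i))%E.

Definition identically_distributed (d' : measure_display)
    (T' : measurableType d') (X : nat -> {RV P >-> T'}) :=
  forall t, distribution P (X t) = distribution P (X 0%N).

End Independence.

Section Routing.
Context (R : realType) (d : measure_display) (T : measurableType d).
Variables (P : probability T R) (L : nat).
Variable S : 'I_L -> nat -> {RV P >-> nat}.

Record service_process (Smax : nat) : Prop := {
  service_bounded : forall l t w, (S l t w <= Smax)%N;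
  service_ident : forall l, identically_distributed (S l)
}.

Definition mu (l : 'I_L) : R := fine 'E_P[fun w => (S l 1%N w)%:R]%E.
Definition mu_sum : R := \sum_(l < L) mu l.
(* The minimum when L > 0. *)
Definition mu_min : R := inf (range mu).

Definition shortest (q : qvec L) : {set 'I_L} :=
  [set l | [forall m : 'I_L, (qval q l <= qval q m)%N]].

Definition send_all (a : nat) (l : 'I_L) : qvec L :=
  [ffun m : 'I_L => if m == l then a else 0%N].

Variables (AS : nat -> {RV P >-> nat}) (A Q : nat -> {RV P >-> qvec L}).

(* Sigma-algebras of the initial state, of the arrivals AS t and of the
   services S l t. *)
Definition source (i : unit + nat + 'I_L * nat) : set_system T :=
  match i with
  | inl (inl _) => g_sigma_algebra_preimage (Q 0%N)
  | inl (inr t) => g_sigma_algebra_preimage (AS t)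
  | inr (l, t) => g_sigma_algebra_preimage (S l t)
  end.

(* Everything but the tie-breaks of slots t, t+1, etc.: the initial state, all
   arrivals, all services, and the routing decisions of the slots before t. *)
Definition tie_info (t : nat) : set_system T :=
  <<s \bigcup_i source i `|`
      \bigcup_(s in [set s | (s < t)%N]) g_sigma_algebra_preimage (A s) >>.

Record routing_system (Amax : nat) : Prop := {
  arrival_bounded : forall t w, (AS t w <= Amax)%N;
  arrival_ident : identically_distributed AS;
  source_independent : mutually_independent P source;
  routing_total : forall t w, (\sum_(l < L) qval (A t w) l)%N = AS t w;
  (* The truncated subtraction on nat is the positive part. *)
  queue_recursion : forall t w l,
    qval (Q t.+1 w) l = (qval (Q t w) l + qval (A t w) l - S l t w)%N
}.

(* jsq_uniform: conditionally on tie_info t, on the set M of shortest queues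
   and on there being a packet to route, the chosen queue is uniform on M. With
   no arrival, all the vectors send_all 0 l coincide. *)
Record jsq : Prop := {
  jsq_shortest : forall t w,
    exists2 l, l \in shortest (Q t w) & A t w = send_all (AS t w) l;
  jsq_uniform : forall t (H : set T) (M : {set 'I_L}) (l : 'I_L),
    tie_info t H -> l \in M ->
    let C := H `&` [set w | shortest (Q t w) = M] `&`
             [set w | (0 < AS t w)%N] in
    P (C `&` [set w | A t w = send_all (AS t w) l]) =
    ((#|M|%:R^-1)%:E * P C)%E
}.

End Routing.

(* The state space is discrete: every function on it is continuous. *)
Definition cvg_in_distribution (R : realType) (L : nat)
    (d d' : measure_display) (T : measurableType d) (T' : measurableType d')
    (P : probability T R) (P' : probability T' R)
    (X : nat -> {RV P >-> qvec L}) (Y : {RV P' >-> qvec L}) : Prop :=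
  forall f : qvec L -> R, (exists c : R, forall q, `|f q| <= c) ->
    'E_P[f \o X t]%E @[t --> \oo] --> 'E_P'[f \o Y]%E.

Definition finite_moments (R : realType) (L : nat) (d : measure_display)
    (T : measurableType d) (P : probability T R) (Y : {RV P >-> qvec L}) :=
  forall (l : 'I_L) (r : nat),
    ('E_P[(fun w => (qval (Y w) l)%:R ^+ r)%R] < +oo)%E.

Definition norm2 (R : realType) (L : nat) (x : 'I_L -> R) : R :=
  Num.sqrt (\sum_(l < L) x l ^+ 2).

Definition perp (R : realType) (L : nat) (q : qvec L) (l : 'I_L) : R :=
  (qval q l)%:R - L%:R^-1 * \sum_(m < L) (qval q m)%:R.

(* Main.v *)
Require Import Defs.
From mathcomp Require Import measurable_realfun ring lra zify.

(* Lyapunov drift for the squared distance n(q) = |q_perp|^2 to the diagonal.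
   Since the entries of q_perp sum to 0, one step of JSQ changes n on average by
   at most c - 2 delta |q_perp|: the arrivals pull the smallest entry up, and each
   service rate exceeds eps / L by delta. One step changes n by O(1 + |q_perp|),
   so a Taylor expansion of n^(k+1) has mean drift at most C - delta |q_perp|^(2k+1),
   with C independent of eps. In the steady state the mean drift of n^(k+1) is 0,
   all moments being finite, whence E |q_perp|^(2k+1) <= C / delta.
   That the steady state is invariant under the averaged one-step map follows from
   the Markov property. The latter is proved by induction on t: the arrivals and
   services of the slots from t on are independent of Q t, because the tie-breaks
   are uniform given everything else. *)

Set Implicit Arguments.
Unset Strict Implicit.
Unset Printing Implicit Defensive.

(** * One-step drift of the squared distance to the diagonal *)

Section Drift.
Context (R : realType) (L : nat).
Hypothesis L_gt0 : (0 < L)%N.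
Implicit Types q : qvec L.

Definition perpsq q : R := \sum_(l < L) perp R q l ^+ 2.

Lemma sum_perp q : \sum_(l < L) perp R q l = 0.
Proof.
rewrite /perp big_split /= sumrN sumr_const card_ord -[X in _ - X]mulr_natl mulrA.
by rewrite mulfV ?pnatr_eq0 -?lt0n // mul1r subrr.
Qed.

Lemma perpsq_ge0 q : 0 <= perpsq q.
Proof. by apply: sumr_ge0 => l _; exact: sqr_ge0. Qed.

Lemma norm2_ge0 q : 0 <= norm2 (perp R q).
Proof. exact: sqrtr_ge0. Qed.

Lemma norm2_sqr q : norm2 (perp R q) ^+ 2 = perpsq q.
Proof. by rewrite /norm2 sqr_sqrtr // perpsq_ge0. Qed.

Lemma perp_le_norm2 q l : `|perp R q l| <= norm2 (perp R q).
Proof.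
rewrite -(ler_pXn2r (n := 2)) ?nnegrE ?norm2_ge0 // norm2_sqr real_normK ?num_real //.
by rewrite /perpsq (bigD1 l) //= lerDl sumr_ge0 // => i _; exact: sqr_ge0.
Qed.

(** Pythagoras: the sum of squares splits into [perpsq q] and the squared component along the
    diagonal. Through this bound the finite moments of the queue lengths pass to [perpsq]. *)
Lemma perpsq_le_sum_sqr q : perpsq q <= \sum_(l < L) (qval q l)%:R ^+ 2.
Proof.
have -> : \sum_(l < L) (qval q l)%:R ^+ 2 =
    perpsq q + L%:R^-1 * (\sum_(m < L) (qval q m)%:R) ^+ 2.
  rewrite /perpsq; set s := \sum_(m < L) _.
  have -> : \sum_(l < L) (qval q l)%:R ^+ 2 =
      \sum_(l < L) (perp R q l ^+ 2 + 2 * L%:R^-1 * s * perp R q l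
                    + (L%:R^-1 * s) ^+ 2).
    by apply: eq_bigr => l _; rewrite /perp -/s; ring.
  rewrite !big_split /= -mulr_sumr sum_perp mulr0 addr0; congr (_ + _).
  rewrite sumr_const card_ord -[X in X = _]mulr_natl; field.
  by rewrite pnatr_eq0 -lt0n.
by rewrite lerDl mulr_ge0 ?invr_ge0 ?ler0n ?sqr_ge0.
Qed.

Lemma perp_gap_ge0 q l m : l \in shortest q -> 0 <= perp R q m - perp R q l.
Proof.
rewrite inE => /forallP /(_ m) qlm.
by rewrite /perp opprD opprK addrACA [X in _ + X]addrC subrr addr0 subr_ge0 ler_nat.
Qed.

(** The entries of [perp R q] sum to 0, so subtracting the constant [perp R q l] from each can only
    enlarge the sum of squares. The resulting gaps are nonnegative, so their sum of squares is at
    most the square of their sum. *)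
Lemma norm2_le_gap q l : l \in shortest q ->
  norm2 (perp R q) <= \sum_(m < L) (perp R q m - perp R q l).
Proof.
move=> lq.
have gap m := perp_gap_ge0 m lq.
have D0 : 0 <= \sum_(m < L) (perp R q m - perp R q l) by exact: sumr_ge0.
rewrite -(ler_pXn2r (n := 2)) ?nnegrE ?norm2_ge0 // norm2_sqr.
apply: (@le_trans _ _ (\sum_(m < L) (perp R q m - perp R q l) ^+ 2)).
  rewrite /perpsq.
  have -> : \sum_(m < L) (perp R q m - perp R q l) ^+ 2 = \sum_(m < L)
      (perp R q m ^+ 2 - 2 * perp R q l * perp R q m + perp R q l ^+ 2).
    by apply: eq_bigr => m _; ring.
  rewrite !big_split /= sumrN -mulr_sumr sum_perp mulr0 oppr0 addr0.
  by rewrite lerDl sumr_ge0 // => i _; exact: sqr_ge0.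
rewrite expr2 mulr_sumr; apply: ler_sum => m _.
rewrite expr2 ler_wpM2r //.
by rewrite (bigD1 m) //= lerDl sumr_ge0.
Qed.

Variables (Amax Smax : nat).

(** The arrivals and services of one slot. Both are bounded, so the type is finite and means over a
    slot are finite sums. *)
Local Notation slot := ('I_Amax.+1 * {ffun 'I_L -> 'I_Smax.+1})%type.

Implicit Type z : slot.

Definition step q l z : qvec L :=
  [ffun m => (qval q m + qval (send_all z.1 l) m - z.2 m)%N].

Let B : R := (Amax + Smax)%:R.

Let incr q l z m : R := (qval (step q l z) m)%:R - (qval q m)%:R.

Lemma incr_bound q l z m : `|incr q l z m| <= B.
Proof.
rewrite /incr /step {1}/qval ffunE /send_all /B {2}/qval ffunE.
have ha := leq_ord z.1; have hs := leq_ord (z.2 m).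
set a := (if m == l then _ else _).
have ha' : (a <= Amax)%N by rewrite /a; case: ifP.
move: (nat_of_ord (z.2 m)) (qval q m) hs => s x hs {ha}.
rewrite ler_distl lerBlDr -!natrD !ler_nat; lia.
Qed.

Let avg q l z : R := L%:R^-1 * \sum_(m < L) incr q l z m.

Lemma avg_bound q l z : `|avg q l z| <= B.
Proof.
rewrite /avg normrM ger0_norm ?invr_ge0 ?ler0n //.
rewrite ler_pdivrMl ?ltr0n //; apply: le_trans (ler_norm_sum _ _ _) _.
apply: (@le_trans _ _ (\sum_(m < L) B)).
  by apply: ler_sum => m _; exact: incr_bound.
by rewrite sumr_const card_ord [leRHS]mulr_natl.
Qed.

Lemma perp_step q l z m :
  perp R (step q l z) m = perp R q m + (incr q l z m - avg q l z).
Proof.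
by rewrite /perp /avg /incr big_split /= sumrN; ring.
Qed.

Lemma perpsq_step q l z : perpsq (step q l z) = perpsq q +
  (2 * \sum_(m < L) perp R q m * incr q l z m
   + \sum_(m < L) (incr q l z m - avg q l z) ^+ 2).
Proof.
rewrite /perpsq; under eq_bigr do rewrite perp_step.
(* The common shift [avg q l z] is orthogonal to [perp R q], whose entries sum to 0. *)
have -> : \sum_(m < L) perp R q m * incr q l z m =
    \sum_(m < L) perp R q m * (incr q l z m - avg q l z).
  under [RHS]eq_bigr do rewrite mulrBr.
  by rewrite big_split /= sumrN -mulr_suml sum_perp mul0r subr0.
rewrite mulr_sumr -!big_split /=; apply: eq_bigr => m _; ring.
Qed.

Let sqr_sum_bound q l z :
  \sum_(m < L) (incr q l z m - avg q l z) ^+ 2 <= L%:R * (2 * B) ^+ 2.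
Proof.
rewrite mulr_natl -[X in _ *+ X]card_ord -sumr_const; apply: ler_sum => m _.
rewrite -(@real_normK _ (_ - _)) ?num_real //.
rewrite ler_pXn2r ?nnegrE ?mulr_ge0 ?ler0n //.
apply: le_trans (ler_normB _ _) _; rewrite mulr_natl mulr2n.
by rewrite lerD // ?incr_bound ?avg_bound.
Qed.

(** The cross term is at most linear in the norm, and the squared increments are bounded. This is
    the growth condition of [pow_taylor_bound]. *)
Lemma perpsq_step_bound : {c : R | 0 <= c &
  forall q l z, `|perpsq (step q l z) - perpsq q| <= c * (1 + norm2 (perp R q))}.
Proof.
have B0 : 0 <= B by rewrite ler0n.
have L0 : 0 <= L%:R :> R by rewrite ler0n.
exists (2 * (L%:R * B) + L%:R * (2 * B) ^+ 2).
  by rewrite addr_ge0 ?mulr_ge0 // sqr_ge0.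
move=> q l z; rewrite perpsq_step addrAC subrr add0r.
apply: le_trans (ler_normD _ _) _.
have hs : `|\sum_(m < L) (incr q l z m - avg q l z) ^+ 2| <= L%:R * (2 * B) ^+ 2.
  by rewrite ger0_norm ?sqr_sum_bound // sumr_ge0 // => m _; exact: sqr_ge0.
have hp : `|2 * \sum_(m < L) perp R q m * incr q l z m| <=
    2 * (L%:R * B) * norm2 (perp R q).
  rewrite normrM ger0_norm // -mulrA ler_wpM2l //.
  apply: le_trans (ler_norm_sum _ _ _) _.
  rewrite -mulrA mulr_natl -[X in _ *+ X]card_ord -sumr_const; apply: ler_sum => m _.
  by rewrite normrM mulrC ler_pM ?incr_bound ?perp_le_norm2.
have n0 := norm2_ge0 q.
apply: le_trans (lerD hp hs) _.
have : 0 <= 2 * (L%:R * B) by rewrite ?mulr_ge0.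
have : 0 <= L%:R * (2 * B) ^+ 2 * norm2 (perp R q).
  by rewrite !mulr_ge0 // sqr_ge0.
nra.
Qed.

Definition drift_const : R := 2 * (L%:R * Smax%:R ^+ 2) + L%:R * (2 * B) ^+ 2.

Lemma drift_const_ge0 : 0 <= drift_const.
Proof. by rewrite addr_ge0 ?mulr_ge0 ?ler0n ?exprn_ge0 ?mulr_ge0 ?ler0n. Qed.

(* The unused service is positive only at queues shorter than [Smax], where the
   entry of [perp] is at most [Smax]. *)
Lemma perpsq_step_le q l z : perpsq (step q l z) <= perpsq q +
  (2 * ((z.1 : nat)%:R * perp R q l
        - \sum_(m < L) (z.2 m : nat)%:R * perp R q m) + drift_const).
Proof.
rewrite perpsq_step lerD2l /drift_const addrA lerD ?sqr_sum_bound //.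
rewrite -mulrDr ler_wpM2l //.
have -> : (z.1 : nat)%:R * perp R q l =
    \sum_(m < L) (qval (send_all z.1 l) m)%:R * perp R q m.
  rewrite (bigD1 l) //= big1 ?addr0 => [|m ml]; rewrite /qval ffunE ?eqxx //.
  by rewrite (negbTE ml) mul0r.
rewrite -sumrN -big_split /= mulr_natl -[X in _ *+ X]card_ord -sumr_const -big_split.
apply: ler_sum => m _ /=.
rewrite -mulrBl mulrC -lerBlDl -mulrBl.
have xs := leq_ord (z.2 m).
have s0 : 0 <= (z.2 m : nat)%:R :> R by rewrite ler0n.
have S0 : 0 <= Smax%:R :> R by rewrite ler0n.
have sS : (z.2 m : nat)%:R <= Smax%:R :> R by rewrite ler_nat.
rewrite /incr /step {1}/qval ffunE.
set a := qval (send_all _ _) _.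
case: (leqP (z.2 m) (qval q m + a)%N) => h.
  rewrite natrB // natrD; set t := (X in X * _).
  by rewrite (_ : t = 0) ?mul0r ?sqr_ge0 // /t; ring.
have h0 : ((qval q m + a) - z.2 m)%N = 0%N by lia.
rewrite h0.
have u0 : 0 <= 0%:R - (qval q m)%:R - (a%:R - (z.2 m : nat)%:R) :> R.
  have : (qval q m + a)%:R <= (z.2 m : nat)%:R :> R by rewrite ler_nat ltnW.
  rewrite natrD; lra.
have uS : 0%:R - (qval q m)%:R - (a%:R - (z.2 m : nat)%:R) <= Smax%:R :> R.
  have := ler0n R a; have := ler0n R (qval q m); lra.
have pS : perp R q m <= Smax%:R.
  have : (qval q m)%:R <= Smax%:R :> R by rewrite ler_nat; lia.
  have : 0 <= L%:R^-1 * \sum_(m0 < L) (qval q m0)%:R :> R.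
    by rewrite mulr_ge0 ?invr_ge0 ?ler0n ?sumr_ge0.
  rewrite /perp; lra.
rewrite expr2; nra.
Qed.

Section MeanDrift.
Variables (w : slot -> R) (lambda : R) (mu : 'I_L -> R) (delta eps : R).
Hypotheses (w_ge0 : forall z, 0 <= w z) (w_sum : \sum_z w z = 1)
  (w_arrival : \sum_z w z * (z.1 : nat)%:R = lambda)
  (w_service : forall l, \sum_z w z * (z.2 l : nat)%:R = mu l)
  (lambdaE : lambda = \sum_(l < L) mu l - eps)
  (mu_ge : forall l, delta <= mu l - eps / L%:R).

(** Here [w] is the law of one slot. The reduced rates [mu m - eps / L%:R] sum to [lambda], so the
    linear term is minus the sum of these rates times the gaps to the shortest queue. Each rate is
    at least [delta], and the gaps add up to at least the norm. *)
Lemma mean_perpsq_drift q l : 0 <= delta -> l \in shortest q ->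
  \sum_z w z * (perpsq (step q l z) - perpsq q) <=
  drift_const - 2 * delta * norm2 (perp R q).
Proof.
move=> d0 lq.
have L0 : (L%:R : R) != 0 by rewrite pnatr_eq0 -lt0n.
apply: (@le_trans _ _ (2 * (lambda * perp R q l - \sum_(m < L) mu m * perp R q m)
    + drift_const)).
  have -> : drift_const = \sum_z w z * drift_const by rewrite -mulr_suml w_sum mul1r.
  rewrite -w_arrival mulr_suml.
  have -> : \sum_(m < L) mu m * perp R q m =
      \sum_z w z * \sum_(m < L) (z.2 m : nat)%:R * perp R q m.
    under [RHS]eq_bigr do rewrite mulr_sumr.
    rewrite exchange_big /=; apply: eq_bigr => m _.
    by rewrite -w_service mulr_suml; apply: eq_bigr => z _; rewrite mulrA.
  rewrite -sumrB mulr_sumr -big_split /=; apply: ler_sum => z _.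
  have := ler_wpM2l (w_ge0 z) (perpsq_step_le q l z).
  lra.
rewrite [leLHS]addrC lerD2l.
have -> : lambda * perp R q l - \sum_(m < L) mu m * perp R q m =
    - \sum_(m < L) (mu m - eps / L%:R) * (perp R q m - perp R q l).
  have -> : \sum_(m < L) (mu m - eps / L%:R) * (perp R q m - perp R q l) =
      \sum_(m < L) (mu m * perp R q m - mu m * perp R q l
         - eps / L%:R * perp R q m + eps / L%:R * perp R q l).
    by apply: eq_bigr => m _; ring.
  rewrite !big_split /= !sumrN -mulr_suml -mulr_sumr sum_perp mulr0 subr0.
  by rewrite sumr_const card_ord -mulr_natl lambdaE; field.
rewrite mulrN lerN2 -mulrA ler_wpM2l //.
apply: (@le_trans _ _ (delta * \sum_(m < L) (perp R q m - perp R q l))).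
  by rewrite ler_wpM2l // norm2_le_gap.
rewrite mulr_sumr; apply: ler_sum => m _; rewrite ler_wpM2r //.
exact: perp_gap_ge0.
Qed.
End MeanDrift.
End Drift.

(** * Expansion of powers and absorption of lower-order terms *)

Section PowerDrift.
Context (R : realType).

(** Since [x] is at most of order [w], the first-order expansion has an error of order [2 * k] in
    [w], one below the order of its linear term. *)
Lemma pow_taylor_bound (c : R) (k : nat) : 0 <= c ->
  {b : R | 0 <= b & forall w x : R, 0 <= w -> `|x| <= c * (1 + w) ->
    (w ^+ 2 + x) ^+ k.+1 <=
      (w ^+ 2) ^+ k.+1 + k.+1%:R * (w ^+ 2) ^+ k * x + b * (1 + w) ^+ (2 * k)}.
Proof.
move=> c0.
(* The induction multiplies the error by [w ^+ 2 + x], whose sign is unknown, so it needs a bound on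
   the absolute value. *)
suff [b b0 hb] : {b : R | 0 <= b & forall w x : R, 0 <= w -> `|x| <= c * (1 + w) ->
    `|(w ^+ 2 + x) ^+ k.+1 - ((w ^+ 2) ^+ k.+1 + k.+1%:R * (w ^+ 2) ^+ k * x)|
    <= b * (1 + w) ^+ (2 * k)}.
  exists b => // w x w0 hx; rewrite -lerBlDl.
  by apply: le_trans (hb _ _ w0 hx); exact: ler_norm.
elim: k => [|k [b b0 hb]].
  by exists 0 => // w x _ _; rewrite muln0 !expr1 !expr0 !mul1r subrr normr0 mul0r.
exists (k.+1%:R * c ^+ 2 + (1 + c) * b).
  by rewrite addr_ge0 ?mulr_ge0 ?addr_ge0 ?ler0n ?sqr_ge0.
move=> w x w0 hx; have := hb _ _ w0 hx; set r := (X in `|X|) => hr.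
(* Recursion for the error: the old error [r] times [w ^+ 2 + x], plus a new term quadratic in
   [x]. *)
have -> : (w ^+ 2 + x) ^+ k.+2 -
    ((w ^+ 2) ^+ k.+2 + k.+2%:R * (w ^+ 2) ^+ k.+1 * x) =
    k.+1%:R * (w ^+ 2) ^+ k * x ^+ 2 + (w ^+ 2 + x) * r.
  rewrite /r mulrBr -exprS.
  rewrite (exprS (w ^+ 2) k.+1) !(exprS (w ^+ 2) k) -(natr1 k.+1).
  set u := (w ^+ 2) ^+ k; ring.
have w1 : 0 <= 1 + w by rewrite addr_ge0.
rewrite mulnS exprD [leRHS]mulrDl; apply: le_trans (ler_normD _ _) _; apply: lerD.
  rewrite 2!normrM normr_nat.
  have -> : k.+1%:R * c ^+ 2 * ((1 + w) ^+ 2 * (1 + w) ^+ (2 * k)) =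
      k.+1%:R * ((c * (1 + w)) ^+ 2 * (1 + w) ^+ (2 * k)) by rewrite exprMn !mulrA.
  rewrite -[leLHS]mulrA ler_wpM2l ?ler0n // [leLHS]mulrC ler_pM //.
    by rewrite normrX lerXn2r ?nnegrE ?mulr_ge0.
  rewrite -exprM normrX ger0_norm // lerXn2r ?nnegrE //; lra.
rewrite normrM mulrACA ler_pM // ?mulr_ge0 ?exprn_ge0 //.
apply: le_trans (ler_normD _ _) _; rewrite ger0_norm ?sqr_ge0 //.
apply: le_trans (lerD (lexx _) hx) _.
nra.
Qed.

(** Beyond the threshold [w0], [1 + w] is at most [2 * w] and the extra factor [w] beats
    [C * 2 ^+ (2 * k) / eta]. Below it, the left side is at most its value at [w0], which is the
    constant. *)
Lemma lower_order_absorb (C eta : R) (k : nat) : 0 <= C -> 0 < eta ->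
  {c : R | 0 <= c & forall w : R, 0 <= w ->
    C * (1 + w) ^+ (2 * k) <= eta * w ^+ (2 * k).+1 + c}.
Proof.
move=> C0 e0; set w0 := 1 + C * 2 ^+ (2 * k) / eta.
have w01 : 1 <= w0.
  by rewrite /w0 lerDl divr_ge0 ?mulr_ge0 ?exprn_ge0 // ltW.
have w00 : 0 <= w0 by lra.
exists (C * (1 + w0) ^+ (2 * k)).
  by rewrite mulr_ge0 // exprn_ge0 // addr_ge0.
move=> w hw; case: (leP w w0) => h.
  rewrite -[leLHS]add0r lerD ?mulr_ge0 ?exprn_ge0 ?(ltW e0) //.
  by rewrite ler_wpM2l //; apply: lerXn2r; rewrite ?nnegrE; lra.
rewrite -[leLHS]addr0 lerD //; last by rewrite mulr_ge0 // exprn_ge0 // addr_ge0.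
apply: (@le_trans _ _ (C * (2 ^+ (2 * k) * w ^+ (2 * k)))).
  rewrite ler_wpM2l // -exprMn lerXn2r ?nnegrE ?addr_ge0 ?mulr_ge0 //; lra.
rewrite exprS mulrA mulrA ler_wpM2r ?exprn_ge0 //.
rewrite -ler_pdivrMl // mulrC; move: h; rewrite /w0; lra.
Qed.
End PowerDrift.

(** * Real-valued probabilities and finite partitions *)

Section RealProbability.
Context (R : realType) (d : measure_display) (T : measurableType d).
Variable P : probability T R.

(** Finite sums and products of probabilities are thus computed in the field of reals rather than in
    the extended reals. *)
Definition prb (X : set T) : R := fine (P X).

Lemma prbE X : measurable X -> P X = (prb X)%:E.
Proof. by move=> mX; rewrite fineK // fin_num_measure. Qed.

Lemma prb_ge0 X : 0 <= prb X.
Proof. exact: fine_ge0. Qed.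

Lemma prb0 : prb set0 = 0.
Proof. by rewrite /prb measure0. Qed.

Lemma prbT : prb setT = 1.
Proof. by rewrite /prb probability_setT. Qed.

Lemma prb_partition (I : finType) (A : {pred I}) (F : I -> set T) (X : set T) :
  measurable X -> (forall i, i \in A -> measurable (X `&` F i)) ->
  (forall x, X x -> exists2 i, i \in A & F i x) ->
  (forall x i j, X x -> F i x -> F j x -> i = j) ->
  prb X = \sum_(i in A) prb (X `&` F i).
Proof.
move=> mX mF cF dF; apply: EFin_inj; rewrite -sumEFin -prbE //.
transitivity (P (\bigcup_(i in [set` enum A]) (X `&` F i))).
  congr (P _); apply/seteqP; split => [x Xx|x [i _ []//]].
  by have [i iA Fi] := cF _ Xx; exists i => //=; rewrite mem_enum.
rewrite measure_fin_bigcup.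
- by rewrite -fsbig_seq ?enum_uniq // big_enum; apply: eq_bigr => i /mF /prbE.
- exact: finite_seq.
- by move=> i j _ _ [x [[Xx Fi] [_ Fj]]]; exact: dF Xx Fi Fj.
- by move=> i /=; rewrite mem_enum => /mF.
Qed.

Lemma prb_finpartition (I : finType) (g : T -> I) (X : set T) :
  measurable X -> (forall i, measurable (g @^-1` [set i])) ->
  prb X = \sum_i prb (X `&` g @^-1` [set i]).
Proof.
move=> mX mg; apply: prb_partition => //.
- by move=> i _; exact: measurableI.
- by move=> x _; exists (g x).
- by move=> x i j _ /= -> ->.
Qed.

Lemma mutually_independent_prb (I : choiceType) (F : I -> set_system T)
    (J : {fset I}) (B : I -> set T) :
  mutually_independent P F -> (forall i, i \in J -> F i (B i)) ->
  (forall i, i \in J -> measurable (B i)) ->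
  prb (\bigcap_(i in [set` J]) B i) = \prod_(i <- J) prb (B i).
Proof.
move=> indF FB mB; rewrite /prb (indF J B FB).
rewrite [X in fine X](_ : _ = (\prod_(i <- J) prb (B i))%:E) //.
by rewrite -prodEFin big_seq [RHS]big_seq; apply: eq_bigr => i /mB /prbE.
Qed.

Lemma integral_finite_rv (I : finType) (g : T -> I) (h : I -> R) :
  (forall i, measurable (g @^-1` [set i])) -> (forall i, 0 <= h i) ->
  (\int[P]_x (h (g x))%:E)%E = (\sum_i prb (g @^-1` [set i]) * h i)%:E.
Proof.
move=> mg h0.
have -> : (fun x => (h (g x))%:E) =
    (fun x => \sum_i ((h i)%:E * (\1_(g @^-1` [set i]) x)%:E)%E).
  apply/funext => x; rewrite (bigD1 (g x)) //= big1 ?adde0 => [|i igx].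
    by rewrite indicE mem_set // mule1.
  rewrite indicE memNset ?mule0 //= => gxi; by rewrite gxi eqxx in igx.
rewrite ge0_integral_sum //; last 2 first.
- move=> i; apply: measurable_funeM; apply/measurable_EFinP.
  exact: measurable_indic.
- by move=> i x _; rewrite mule_ge0 ?lee_fin.
rewrite -sumEFin; apply: eq_bigr => i _.
rewrite ge0_integralZl //.
- by rewrite integral_indic // setIT EFinM muleC; congr (_ * _)%E; exact: prbE.
- by apply/measurable_EFinP; exact: measurable_indic.
- by rewrite lee_fin.
Qed.

End RealProbability.

(** * Finite operations in generated sigma-algebras *)

Section SigmaAlgebra.
Context (T : pointedType) (U : set_system T).

Lemma g_salgebra_fin_bigcup (I : finType) (A : set I) (F : I -> set T) :
  (forall i, A i -> <<s U >> (F i)) -> <<s U >> (\bigcup_(i in A) F i).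
Proof.
by move=> UF; apply: (@fin_bigcup_measurable _ (g_sigma_algebraType U)).
Qed.

Lemma g_salgebra_fin_bigcap (I : Type) (A : set I) (F : I -> set T) :
  finite_set A ->
  (forall i, A i -> <<s U >> (F i)) -> <<s U >> (\bigcap_(i in A) F i).
Proof.
by move=> fA UF; apply: (@fin_bigcap_measurable _ (g_sigma_algebraType U)).
Qed.

Lemma g_salgebraI (A B : set T) : <<s U >> A -> <<s U >> B -> <<s U >> (A `&` B).
Proof. exact: (@measurableI _ (g_sigma_algebraType U)). Qed.

End SigmaAlgebra.

(** * Integration against a finite mixture of image measures *)

Section Mixture.
Context (R : realType) (d : measure_display) (U : measurableType d).
Variable m : measure U R.
Local Open Scope ereal_scope.

Lemma ge0_integral_mrestr (D : set U) (mD : measurable D) (f : U -> \bar R) :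
  measurable_fun setT f -> (forall x, 0 <= f x) ->
  \int[mrestr m mD]_x f x = \int[m]_(x in D) f x.
Proof.
move=> mf f0; rewrite -(setUv D) ge0_integral_setU //.
- rewrite (@eq_measure_integral _ _ _ _ m) => [|A mA AD]; last first.
    by rewrite /= /mrestr setIidl.
  rewrite [X in _ + X](@eq_measure_integral _ _ _ _ mzero) => [|A mA AD].
    by rewrite integral_measure_zero adde0.
  by rewrite /= /mrestr /mzero (_ : A `&` D = set0) ?measure0 //; exact/disjoints_subset.
- exact: measurableC.
- by rewrite setUv.
- by apply/disj_setPS => x [].
Qed.

Variables (I : finType) (k : I -> R) (D : I -> set U) (h : I -> U -> U).
Hypotheses (k_ge0 : forall i, (0 <= k i)%R) (mD : forall i, measurable (D i))
  (mh : forall i, measurable_fun setT (h i)).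
Hypothesis mixture : forall C, measurable C ->
  m C = \sum_i (k i)%:E * m (D i `&` h i @^-1` C).

(** Summand [i] is the scaled image under [h i] of [m] restricted to [D i], so [m] is a finite sum
    of measures and the integral splits accordingly. *)
Lemma ge0_integral_mixture (f : U -> \bar R) :
  measurable_fun setT f -> (forall x, 0 <= f x) ->
  \int[m]_x f x = \sum_i (k i)%:E * \int[m]_(x in D i) f (h i x).
Proof.
move=> mf f0.
(* An element of [I] serves as the default of [nth]; over an empty [I] the measure [m] is zero. *)
have [i0 _|I0] := pickP I; last first.
  have e : index_enum I = [::] by case: (index_enum I) => // i; have := I0 i.
  rewrite e big_nil (@eq_measure_integral _ _ _ _ mzero) => [|A mA _].
    by rewrite integral_measure_zero.
  by rewrite mixture // e big_nil.
have push i : {p : measure U R | forall A, p A = m (D i `&` h i @^-1` A) &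
    \int[p]_x f x = \int[m]_(x in D i) f (h i x)}.
  unshelve eexists (pushforward (mrestr m (mD i)) (h i)); first exact: mh.
    by move=> A; rewrite /pushforward /= /mrestr setIC.
  rewrite ge0_integral_pushforward //.
  rewrite preimage_setT ge0_integral_mrestr // => [|x]; last exact: f0.
  exact: (measurableT_comp mf (mh i)).
pose mu_ i : measure U R := mscale (NngNum (k_ge0 i)) (s2val (push i)).
pose ms (n : nat) := mu_ (nth i0 (index_enum I) n).
rewrite (@eq_measure_integral _ _ _ _ (msum ms (size (index_enum I)))) => [|A mA _].
  rewrite ge0_integral_measure_sum // (big_nth i0) big_mkord.
  apply: eq_bigr => n _; rewrite ge0_integral_mscale //=; congr (_ * _).
  exact: (s2valP' (push _)).
rewrite mixture // (big_nth i0) big_mkord /msum /=; apply: eq_bigr => n _.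
by congr (_ * _); exact/esym/(s2valP (push _)).
Qed.

End Mixture.

(** * Markov property of the queue lengths under JSQ *)

Section JSQ.
Context (R : realType) (L : nat) (Amax Smax : nat).
Context (d : measure_display) (T : measurableType d).
Variables (P : probability T R) (S : 'I_L -> nat -> {RV P >-> nat}).
Variables (AS : nat -> {RV P >-> nat}) (A Q : nat -> {RV P >-> qvec L}).
Hypotheses (service : service_process S Smax)
  (routing : routing_system S AS A Q Amax) (JSQ : jsq S AS A Q).

Local Notation slot := ('I_Amax.+1 * {ffun 'I_L -> 'I_Smax.+1})%type.
Local Notation index := (unit + nat + 'I_L * nat)%type.
Local Notation prb := (prb P).

(** [inord] would send out-of-range values to 0; the bounds [Amax] and [Smax] exclude this. *)
Definition slot_at (t : nat) (w : T) : slot :=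
  (inord (AS t w), [ffun l => inord (S l t w)]).

Lemma slot_at1 t w : (slot_at t w).1 = AS t w :> nat.
Proof. by rewrite /= inordK // ltnS (arrival_bounded routing). Qed.

Lemma slot_at2 t w l : (slot_at t w).2 l = S l t w :> nat.
Proof. by rewrite /= ffunE inordK // ltnS (service_bounded service). Qed.

Lemma slot_at_eqP t w z :
  slot_at t w = z <-> AS t w = z.1 /\ forall l, S l t w = z.2 l.
Proof.
split=> [<-|[h1 h2]]; first by split=> [|l]; rewrite ?slot_at1 ?slot_at2.
apply: injective_projections.
  by apply: val_inj; rewrite -[RHS]h1; exact: slot_at1.
by apply/ffunP => l; apply: val_inj; rewrite -[RHS]h2; exact: slot_at2.
Qed.

Definition slot_sources (t : nat) : seq index :=
  inl (inr t) :: [seq inr (l, t) | l <- enum 'I_L].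

(** The value [setT] is a filler: the initial state is not among [slot_sources t]. *)
Definition slot_event (t : nat) (z : slot) (i : index) : set T :=
  match i with
  | inl (inl _) => setT
  | inl (inr _) => [set w | AS t w = z.1]
  | inr (l, _) => [set w | S l t w = z.2 l]
  end.

Lemma slot_at_preimage t z : slot_at t @^-1` [set z] =
  \bigcap_(i in [set` slot_sources t]) slot_event t z i.
Proof.
apply/seteqP; split => w /=.
  move=> /slot_at_eqP[h1 h2] i /=; rewrite in_cons => /orP[/eqP -> //|].
  by case/mapP => l _ ->; exact: h2.
move=> h; apply/slot_at_eqP; split => [|l].
  by apply: (h (inl (inr t))); rewrite /= in_cons eqxx.
by apply: (h (inr (l, t))); rewrite /= in_cons map_f ?mem_enum ?orbT.
Qed.

Lemma slot_event_source t z i : i \in slot_sources t ->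
  source S AS Q i (slot_event t z i).
Proof.
rewrite in_cons => /orP[/eqP ->|/mapP[l _ ->]] /=.
  by exists [set (z.1 : nat)] => //; rewrite setTI.
by exists [set (z.2 l : nat)] => //; rewrite setTI.
Qed.

Lemma source_measurable i X : source S AS Q i X -> measurable X.
Proof.
by case: i => [[i|t]|[l t]] /= [Y mY <-];
  exact: (measurable_funPT _ measurableT Y mY).
Qed.

(** The law of [slot_at t] for every [t]: a product because the sources are independent, and
    evaluated at slot 0 because they are identically distributed in time. *)
Definition slot_weight (z : slot) : R :=
  prb (AS 0%N @^-1` [set (z.1 : nat)]) *
  \prod_(l < L) prb (S l 0%N @^-1` [set (z.2 l : nat)]).

Lemma prod_slot_event t z :
  \prod_(i <- slot_sources t) prb (slot_event t z i) = slot_weight z.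
Proof.
rewrite /slot_sources big_cons big_map big_enum /=; congr (_ * _).
  rewrite /prb; congr fine.
  exact: (congr1 (fun m => m [set (z.1 : nat)]) (arrival_ident routing t)).
apply: eq_bigr => l _; rewrite /prb; congr fine.
exact: (congr1 (fun m => m [set (z.2 l : nat)]) (service_ident service l t)).
Qed.

Lemma uniq_slot_sources t : uniq (slot_sources t).
Proof.
rewrite /= map_inj_uniq ?enum_uniq ?andbT => [|l m [//]].
by apply/mapP => -[].
Qed.

Definition future (t : nat) (i : index) : bool :=
  match i with
  | inl (inl _) => false
  | inl (inr s) => (t <= s)%N
  | inr (_, s) => (t <= s)%N
  end.

Lemma futureS t i : future t i = (i \in slot_sources t) || future t.+1 i.
Proof.
case: i => [[i|s]|[l s]]; rewrite in_cons /=.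
- by apply/esym/negbTE; rewrite orbF; apply/mapP => -[].
- have -> : ((inl (inr s) : index) \in [seq inr (l, t) | l <- enum 'I_L]) = false.
    by apply/negbTE/mapP => -[].
  by rewrite orbF leq_eqVlt eq_sym.
- have -> : ((inr (l, s) : index) \in [seq inr (l, t) | l <- enum 'I_L]) = (s == t).
    by apply/mapP/eqP => [[m _ [_ ->//]]|->]; exists l; rewrite ?mem_enum.
  by rewrite leq_eqVlt eq_sym.
Qed.

Lemma slot_sourcesN t i : future t.+1 i -> i \notin slot_sources t.
Proof.
move=> fi; rewrite in_cons; apply/negP => /orP[/eqP ei|/mapP[l _ ei]];
by move: fi; rewrite ei /= ltnn.
Qed.

Lemma measurable_slot_at t z : measurable (slot_at t @^-1` [set z]).
Proof.
rewrite slot_at_preimage; apply: fin_bigcap_measurable; first exact: finite_seq.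
by move=> i /= it; apply: (@source_measurable i); exact: slot_event_source.
Qed.

Lemma prb_slot_at t z : prb (slot_at t @^-1` [set z]) = slot_weight z.
Proof.
have e : [set` slot_sources t] = [set` [fset i in slot_sources t]%fset].
  by apply/seteqP; split => i /=; rewrite in_fset.
rewrite slot_at_preimage e.
have src i : i \in [fset i in slot_sources t]%fset ->
    source S AS Q i (slot_event t z i).
  by rewrite in_fset; exact: slot_event_source.
rewrite (mutually_independent_prb (source_independent routing)) //.
  rewrite -(prod_slot_event t z); apply: perm_big; apply: uniq_perm.
  - exact: fset_uniq.
  - exact: uniq_slot_sources.
  - by move=> i; rewrite in_fset.
by move=> i /src; exact: source_measurable.
Qed.

Lemma slot_weight_ge0 z : 0 <= slot_weight z.
Proof. by rewrite -(prb_slot_at 0) prb_ge0. Qed.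

Lemma sum_slot_weight : \sum_z slot_weight z = 1.
Proof.
rewrite -(prbT P) (@prb_finpartition _ _ _ P _ (slot_at 0)) //.
  by apply: eq_bigr => z _; rewrite setTI prb_slot_at.
exact: measurable_slot_at.
Qed.

Lemma expectation_slot t (h : slot -> R) : (forall z, 0 <= h z) ->
  (\int[P]_w (h (slot_at t w))%:E)%E = (\sum_z slot_weight z * h z)%:E.
Proof.
move=> h0; rewrite integral_finite_rv //; last exact: measurable_slot_at.
by congr EFin; apply: eq_bigr => z _; rewrite prb_slot_at.
Qed.

Lemma sum_slot_arrival : (\sum_z slot_weight z * (z.1 : nat)%:R)%:E =
  'E_P[fun w => (AS 1%N w)%:R]%E.
Proof.
rewrite expectation.unlock; apply/esym.
rewrite -[RHS](@expectation_slot 1 (fun z => (z.1 : nat)%:R)) => [|z]; last exact: ler0n.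
by apply: eq_integral => w _; rewrite slot_at1.
Qed.

Lemma sum_slot_service l : \sum_z slot_weight z * (z.2 l : nat)%:R = mu S l.
Proof.
rewrite /mu expectation.unlock.
transitivity (fine (\int[P]_w ((slot_at 1 w).2 l : nat)%:R%:E)%E).
  by rewrite (@expectation_slot 1 (fun z => (z.2 l : nat)%:R)) // => z; exact: ler0n.
by congr fine; apply: eq_integral => w _; rewrite slot_at2.
Qed.

Lemma queue_step t w l : A t w = send_all (AS t w) l ->
  Q t.+1 w = step (Q t w) l (slot_at t w).
Proof.
move=> At; apply/ffunP => m; rewrite /step ffunE.
by rewrite -[LHS]/(qval _ m) (queue_recursion routing) At slot_at1 slot_at2.
Qed.

Lemma tie_info_source t i X : source S AS Q i X -> tie_info S AS A Q t X.
Proof. by move=> sX; apply: sub_sigma_algebra; left; exists i. Qed.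

Lemma tie_info_slot_at t s z : tie_info S AS A Q t (slot_at s @^-1` [set z]).
Proof.
rewrite slot_at_preimage; apply: g_salgebra_fin_bigcap; first exact: finite_seq.
by move=> i /= si; apply: (@tie_info_source _ i); exact: slot_event_source.
Qed.

(** By induction on [s]: [Q s.+1] is determined by [Q s], the slot [s] and the decision [A s], which
    belongs to [tie_info] at [t] as [s < t]. Hence [jsq_uniform] applies to events of [Q t]. *)
Lemma tie_info_queue t s C : (s <= t)%N -> tie_info S AS A Q t (Q s @^-1` C).
Proof.
elim: s C => [|s IH] C st.
  by apply: (@tie_info_source _ (inl (inl tt))); exists C; rewrite ?setTI.
have -> : Q s.+1 @^-1` C = \bigcup_(k in [set: 'I_L * slot])
    (slot_at s @^-1` [set k.2] `&` A s @^-1` [set send_all k.2.1 k.1] `&`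
     Q s @^-1` [set q | C (step q k.1 k.2)]).
  apply/seteqP; split => w /=.
    move=> Cw; have [l _ Al] := jsq_shortest JSQ s w.
    exists (l, slot_at s w) => //=; rewrite Al slot_at1; split => //.
    by rewrite -queue_step.
  move=> [[l z] _ [[/= <- Al] CQ]].
  by rewrite (@queue_step _ _ l) // Al slot_at1.
apply: g_salgebra_fin_bigcup => -[l z] _ /=.
apply: g_salgebraI; last exact: IH (ltnW st).
apply: g_salgebraI; first exact: tie_info_slot_at.
apply: sub_sigma_algebra; right; exists s => //=.
by exists [set send_all z.1 l]; rewrite ?setTI.
Qed.

Lemma measurable_queue t C : measurable (Q t @^-1` C).
Proof. by rewrite -[X in measurable X]setTI; exact: measurable_funP. Qed.

(** Fixing the set [M] of shortest queues makes the probability of each tie-break constant on the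
    event. *)
Definition step_event (M : {set 'I_L}) (l : 'I_L) (z : slot) (C : set (qvec L)) :
  set (qvec L) := [set q | shortest q = M /\ C (step q l z)].

Section Step.
Variables (t : nat) (J : {fset index}) (B : index -> set T).
Hypothesis JB : forall i, i \in J -> source S AS Q i (B i) /\ future t.+1 i.

(** An event of the slots after [t], carried along so that independence of the future passes from
    [Q t] to [Q t.+1]. *)
Let H : set T := \bigcap_(i in [set` J]) B i.

Let mH : measurable H.
Proof.
apply: fin_bigcap_measurable; first exact: finite_fset.
by move=> i /= /JB[sB _]; exact: source_measurable sB.
Qed.

Let tie_info_H : tie_info S AS A Q t H.
Proof.
apply: g_salgebra_fin_bigcap; first exact: finite_fset.
by move=> i /= /JB[sB _]; exact: tie_info_source sB.
Qed.

Let slot_future M l z C : set T :=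
  H `&` slot_at t @^-1` [set z] `&` Q t @^-1` step_event M l z C.

Let measurable_slot_future M l z C : measurable (slot_future M l z C).
Proof.
apply: measurableI; last exact: measurable_queue.
by apply: measurableI => //; exact: measurable_slot_at.
Qed.

Let next_event M z C : set T := H `&` Q t.+1 @^-1` C `&`
  (fun w => shortest (Q t w)) @^-1` [set M] `&` slot_at t @^-1` [set z].

Let measurable_next_event M z C : measurable (next_event M z C).
Proof.
apply: measurableI; last exact: measurable_slot_at.
apply: measurableI; last exact: (@measurable_queue t [set q | shortest q = M]).
by apply: measurableI => //; exact: measurable_queue.
Qed.

Let measurable_choice l : measurable [set w | A t w = send_all (AS t w) l].
Proof.
have -> : [set w | A t w = send_all (AS t w) l] =
    \bigcup_z (slot_at t @^-1` [set z] `&` A t @^-1` [set send_all z.1 l]).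
  apply/seteqP; split => w /= h; last by case: h => z _ [/= <-]; rewrite slot_at1.
  by exists (slot_at t w) => //; split => //=; rewrite slot_at1.
apply: fin_bigcup_measurable => // z _; apply: measurableI.
  exact: measurable_slot_at.
by rewrite -[X in measurable X]setTI; exact: measurable_funP.
Qed.

(** Given [tie_info], the chosen queue is uniform on [M]. It can be read off [A t] only if there is
    a packet to route, hence the two cases. *)
Lemma prb_next_event M z C : prb (next_event M z C) =
  \sum_(l in M) #|M|%:R^-1 * prb (slot_future M l z C).
Proof.
have nextE w l : A t w = send_all (AS t w) l -> slot_at t w = z ->
    Q t.+1 w = step (Q t w) l z by move=> /queue_step -> ->.
have [z0|z_gt0] := posnP z.1.
  (* Without arrivals the step does not depend on the chosen queue. *)
  have eqF l : l \in M -> slot_future M l z C = next_event M z C.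
    move=> lM; have sa w : slot_at t w = z -> Q t.+1 w = step (Q t w) l z.
      move=> zw; apply: nextE => //.
      have [m _ ->] := jsq_shortest JSQ t w.
      by rewrite -slot_at1 zw z0; apply/ffunP => j; rewrite !ffunE !if_same.
    apply/seteqP; split => w /=.
      by move=> [[Hw zw] [sM CQ]]; do 3!split => //=; rewrite sa.
    by move=> [[[Hw CQ] sM] zw]; do 2!split => //=; rewrite -sa.
  (* Some queue is always shortest, so for an empty [M] both sides are 0. *)
  have [M0|[l lM]] := set_0Vmem M.
    rewrite M0 big_set0 (_ : next_event _ _ _ = set0) ?prb0 //.
    apply/seteqP; split => w //= -[[_ sM] _].
    by have [l] := jsq_shortest JSQ t w; rewrite sM inE.
  under eq_bigr => k kM do rewrite eqF //.
  rewrite sumr_const -mulrnAl -mulr_natr mulVf ?mul1r // pnatr_eq0.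
  by rewrite -lt0n card_gt0; apply/set0Pn; exists l.
(* With a packet to route, distinct queues give distinct vectors [send_all], so the decisions
   partition the event. *)
rewrite (@prb_partition _ _ _ P _ [pred l | l \in M]
    (fun l => [set w | A t w = send_all (AS t w) l])) //.
- apply: eq_bigr => l lM; apply: EFin_inj.
  rewrite EFinM -!prbE //; last exact: measurableI.
  have := @jsq_uniform _ _ _ _ _ _ _ _ _ JSQ t (slot_future M l z C) M l _ lM.
  have -> : slot_future M l z C `&` [set w | shortest (Q t w) = M] `&`
      [set w | (0 < AS t w)%N] = slot_future M l z C.
    apply/seteqP; split => w /=; first by case=> -[].
    move=> [[Hw zw] [sM CQ]]; do !split => //=.
    by rewrite -slot_at1 zw.
  move=> <-; last first.
    apply: g_salgebraI; last exact: tie_info_queue.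
    by apply: g_salgebraI => //; exact: tie_info_slot_at.
  congr (P _); apply/seteqP; split => w /=.
    by move=> [[[[Hw CQ] sM] zw] Al]; do !split => //=; rewrite -(nextE _ _ Al).
  by move=> [[[Hw zw] [sM CQ]] Al]; do !split => //=; rewrite (nextE _ _ Al).
- by move=> l _; exact: measurableI.
- move=> w [[_ /= sM] _]; have [l lM Al] := jsq_shortest JSQ t w.
  by exists l => //; rewrite inE -sM.
- move=> w l m [_ /= zw] /= -> /ffunP /(_ l); rewrite !ffunE eqxx -slot_at1 zw.
  by case: eqP => // _ zz; move: z_gt0; rewrite zz.
Qed.

(** The image of the law [m] under the transition kernel of JSQ, as a finite sum in which limits can
    be taken term by term. *)
Definition next_law (m : set (qvec L) -> R) (C : set (qvec L)) : R :=
  \sum_(M : {set 'I_L}) \sum_(z : slot) \sum_(l in M)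
    #|M|%:R^-1 * (slot_weight z * m (step_event M l z C)).

Lemma prb_next C :
  (forall M l z, prb (slot_future M l z C) =
     \prod_(i <- J) prb (B i) * slot_weight z * prb (Q t @^-1` step_event M l z C)) ->
  prb (H `&` Q t.+1 @^-1` C) =
  \prod_(i <- J) prb (B i) * next_law (fun D => prb (Q t @^-1` D)) C.
Proof.
move=> hyp.
have mHC : measurable (H `&` Q t.+1 @^-1` C).
  by apply: measurableI => //; exact: measurable_queue.
have mM M : measurable ((fun w => shortest (Q t w)) @^-1` [set M]).
  exact: (@measurable_queue t [set q | shortest q = M]).
rewrite (@prb_finpartition _ _ _ P _ (fun w => shortest (Q t w))) //.
rewrite /next_law mulr_sumr; apply: eq_bigr => M _.
rewrite (@prb_finpartition _ _ _ P _ (slot_at t)); last 2 first.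
- exact: measurableI.
- exact: measurable_slot_at.
rewrite mulr_sumr; apply: eq_bigr => z _; rewrite prb_next_event mulr_sumr.
by apply: eq_bigr => l _; rewrite hyp; ring.
Qed.

End Step.

(** The induction statement behind the Markov property, for finitely many source events, the form in
    which [mutually_independent] is given. *)
Definition future_independent (t : nat) : Prop :=
  forall (J : {fset index}) (B : index -> set T) C,
    (forall i, i \in J -> source S AS Q i (B i) /\ future t i) ->
    prb (\bigcap_(i in [set` J]) B i `&` Q t @^-1` C) =
    \prod_(i <- J) prb (B i) * prb (Q t @^-1` C).

(** The sources of slot [t] are adjoined to [J], which lies strictly later and is thus disjoint from
    them. Independence at [t] then splits off both the later events and the weight of the slot. *)
Lemma prb_next_queue t (J : {fset index}) (B : index -> set T) D :
  future_independent t ->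
  (forall i, i \in J -> source S AS Q i (B i) /\ future t.+1 i) ->
  prb (\bigcap_(i in [set` J]) B i `&` Q t.+1 @^-1` D) =
  \prod_(i <- J) prb (B i) * next_law (fun E => prb (Q t @^-1` E)) D.
Proof.
move=> indep JB; apply: prb_next => // M l z.
pose K := [fset i in slot_sources t]%fset.
(* One family of events for [J] and slot [t] together. *)
pose B1 i := if i \in slot_sources t then slot_event t z i else B i.
have B1J i : i \in J -> B1 i = B i.
  by move=> /JB[_ /slot_sourcesN/negbTE] ft; rewrite /B1 ft.
have B1K i : i \in slot_sources t -> B1 i = slot_event t z i.
  by rewrite /B1 => ->.
rewrite (_ : _ `&` _ `&` _ =
    \bigcap_(i in [set` (J `|` K)%fset]) B1 i `&` Q t @^-1` step_event M l z D).
  rewrite indep; last first.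
    move=> i; rewrite in_fsetU in_fset => /orP[iJ|iK].
      by rewrite B1J //; have [sB fi] := JB _ iJ; rewrite futureS fi orbT.
    by rewrite B1K // futureS iK; split => //; exact: slot_event_source.
  congr (_ * _).
  have -> : \prod_(i <- (J `|` K)%fset) prb (B1 i) =
      \prod_(i <- enum_fset J ++ slot_sources t) prb (B1 i).
    apply: perm_big; apply: uniq_perm.
    - exact: fset_uniq.
    - rewrite cat_uniq fset_uniq uniq_slot_sources andbT andTb.
      apply/hasPn => i iK; apply/negP => /JB[_ /slot_sourcesN].
      by rewrite iK.
    - by move=> i; rewrite in_fsetU in_fset mem_cat.
  rewrite big_cat /= -(prod_slot_event t z); congr (_ * _).
    by rewrite big_seq [RHS]big_seq; apply: eq_bigr => i /B1J ->.
  by rewrite big_seq [RHS]big_seq; apply: eq_bigr => i /B1K ->.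
congr (_ `&` _); rewrite slot_at_preimage; apply/seteqP; split => w /=.
  move=> [Hw Kw] i /=; rewrite in_fsetU in_fset => /orP[iJ|iK].
    by rewrite B1J //; exact: Hw.
  by rewrite B1K //; exact: Kw.
move=> Hw; split => i /= ii.
  by rewrite -B1J //; apply: Hw; rewrite /= in_fsetU ii.
by rewrite -B1K //; apply: Hw; rewrite /= in_fsetU in_fset ii orbT.
Qed.

Lemma prb_queue_step_of t C : future_independent t ->
  prb (Q t.+1 @^-1` C) = next_law (fun D => prb (Q t @^-1` D)) C.
Proof.
move=> indep; have := @prb_next_queue t fset0 (fun=> setT) C indep.
rewrite big_seq_fset0 mul1r => <- //.
by congr (prb _); rewrite set_fset0 bigcap_set0 setTI.
Qed.

(** At time 0, [Q 0] is itself one of the independent sources and is adjoined as the index [i0]. In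
    the step, [prb_next_queue] for [J] and for the empty family produce the same [next_law]
    factor. *)
Lemma future_independent_queue t : future_independent t.
Proof.
elim: t => [|t IH] J B C JB.
  set i0 : index := inl (inl tt).
  have i0J : i0 \notin J by apply/negP => /JB[].
  pose B' i := if i == i0 then Q 0%N @^-1` C else B i.
  have B'0 : B' i0 = Q 0%N @^-1` C by rewrite /B' eqxx.
  have BB' i : i \in J -> B' i = B i.
    by rewrite /B'; case: eqP => // -> iJ; rewrite iJ in i0J.
  have JB' i : i \in (i0 |` J)%fset -> source S AS Q i (B' i).
    rewrite /B' in_fset1U; case: eqP => [-> _|_ /= /JB[]//].
    by exists C; rewrite ?setTI.
  have mB' i : i \in (i0 |` J)%fset -> measurable (B' i).
    by move=> /JB'; exact: source_measurable.
  have := mutually_independent_prb (source_independent routing) JB' mB'.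
  rewrite big_fsetU1 //= B'0 mulrC => e.
  transitivity (prb (\bigcap_(i in [set` (i0 |` J)%fset]) B' i)).
    congr (prb _); apply/seteqP; split => w /=.
      move=> [Hw Cw] i /=; rewrite in_fset1U => /orP[/eqP ->|iJ].
        by rewrite B'0.
      by rewrite BB' //; exact: Hw.
    move=> Hw; split.
      move=> i /= iJ; rewrite -BB' //; apply: Hw => /=.
      by rewrite in_fset1U iJ orbT.
    rewrite -[C _]/((Q 0%N @^-1` C) w) -B'0; apply: Hw; by rewrite /= fset1U1.
  rewrite e; congr (_ * _).
  by rewrite big_seq [RHS]big_seq; apply: eq_bigr => i /BB' ->.
rewrite prb_next_queue // prb_queue_step_of //.
Qed.

Lemma prb_queue_step t C :
  prb (Q t.+1 @^-1` C) = next_law (fun D => prb (Q t @^-1` D)) C.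
Proof. by apply: prb_queue_step_of; exact: future_independent_queue. Qed.

End JSQ.

(** * Mean drift of powers of the squared distance *)

Section PowerMeanDrift.
Context (R : realType) (L Amax Smax : nat).
Hypothesis L_gt0 : (0 < L)%N.
Local Notation slot := ('I_Amax.+1 * {ffun 'I_L -> 'I_Smax.+1})%type.

(** The constant precedes the slot law and [eps], which makes the final bound uniform in [eps]. The
    drift supplies at least [2 * delta] times the odd power of the norm: one half absorbs the
    lower-order terms, the other half remains. *)
Lemma pow_mean_drift (delta : R) (k : nat) : 0 < delta ->
  {C : R | 0 <= C & forall (w : slot -> R) (mu : 'I_L -> R) (eps : R),
    (forall z, 0 <= w z) -> \sum_z w z = 1 ->
    \sum_z w z * (z.1 : nat)%:R = \sum_(l < L) mu l - eps ->
    (forall l, \sum_z w z * (z.2 l : nat)%:R = mu l) ->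
    (forall l, delta <= mu l - eps / L%:R) ->
    forall (q : qvec L) l, l \in shortest q ->
      \sum_z w z * perpsq R (step q l z) ^+ k.+1 +
        delta * norm2 (perp R q) ^+ (2 * k).+1 <= perpsq R q ^+ k.+1 + C}.
Proof.
move=> d0.
have [c c0 hc] := perpsq_step_bound R L_gt0 Amax Smax.
have [b b0 hb] := pow_taylor_bound k c0.
have C1 := drift_const_ge0 R L Amax Smax.
set c1 := drift_const R L Amax Smax in C1.
have A0 : 0 <= k.+1%:R * c1 + b by rewrite addr_ge0 ?mulr_ge0 ?ler0n.
have [C C0 hC] := lower_order_absorb k A0 d0.
exists C => // w mu eps w0 w1 wa ws md q l lq.
set nu := norm2 (perp R q); have nu0 : 0 <= nu := norm2_ge0 R q.
have drift : \sum_z w z * (perpsq R (step q l z) - perpsq R q) <=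
    c1 - 2 * delta * nu.
  exact: (mean_perpsq_drift L_gt0 w0 w1 wa ws erefl md (ltW d0) lq).
have h : \sum_z w z * perpsq R (step q l z) ^+ k.+1 <=
    perpsq R q ^+ k.+1 + k.+1%:R * perpsq R q ^+ k *
      (\sum_z w z * (perpsq R (step q l z) - perpsq R q)) + b * (1 + nu) ^+ (2 * k).
  have wE x : x = \sum_z w z * x by rewrite -mulr_suml w1 mul1r.
  rewrite [X in X + _ + _]wE [X in _ + _ + X]wE mulr_sumr.
  rewrite -!big_split /=; apply: ler_sum => z _.
  rewrite [X in _ + X + _]mulrCA -!mulrDr ler_wpM2l //.
  have := hb nu (perpsq R (step q l z) - perpsq R q) nu0 (hc q l z).
  by rewrite /nu norm2_sqr addrC subrK.
have hn : perpsq R q = nu ^+ 2 by rewrite norm2_sqr.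
rewrite -lerBrDr; apply: le_trans h _; rewrite -addrA -addrA lerD2l.
have u0 : 0 <= perpsq R q ^+ k by rewrite exprn_ge0 // perpsq_ge0.
have uE : perpsq R q ^+ k = nu ^+ (2 * k) by rewrite hn -exprM.
have k0 : 0 <= k.+1%:R * perpsq R q ^+ k by rewrite mulr_ge0 ?ler0n.
apply: le_trans (lerD (ler_wpM2l k0 drift) (lexx _)) _.
have := hC nu nu0.
rewrite exprS; set v := (1 + nu) ^+ (2 * k).
have uv : perpsq R q ^+ k <= v.
  by rewrite uE /v; apply: lerXn2r; rewrite ?nnegrE; lra.
rewrite -uE; set u := perpsq R q ^+ k in u0 uv *.
have k1 : 1 <= k.+1%:R :> R by rewrite ler1n.
have h1 : k.+1%:R * c1 * u <= k.+1%:R * c1 * v.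
  by rewrite ler_wpM2l // mulr_ge0 ?ler0n.
have h2 : delta * (nu * u) <= k.+1%:R * (delta * (nu * u)).
  by rewrite ler_peMl // !mulr_ge0 // ltW.
lra.
Qed.

End PowerMeanDrift.

(** * Passage to the limit and invariance of the steady state *)

Lemma cvgn_sum (R : realType) (I : Type) (r : seq I) (p : pred I)
    (u : I -> nat -> R) (l : I -> R) :
  (forall i, u i t @[t --> \oo] --> l i) ->
  \sum_(i <- r | p i) u i t @[t --> \oo] --> \sum_(i <- r | p i) l i.
Proof.
move=> ul; elim: r => [|i r IH].
  by rewrite big_nil; under eq_fun do rewrite big_nil; exact: cvg_cst.
rewrite big_cons; under eq_fun do rewrite big_cons.
by case: ifP => // _; exact: cvgD.
Qed.

(** The indicator of [C] is a bounded test function, the state space being discrete. *)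
Lemma cvg_in_distribution_prb (R : realType) (L : nat)
    (d d' : measure_display) (T : measurableType d) (T' : measurableType d')
    (P : probability T R) (P' : probability T' R)
    (X : nat -> {RV P >-> qvec L}) (Y : {RV P' >-> qvec L}) (C : set (qvec L)) :
  cvg_in_distribution X Y ->
  prb P (X t @^-1` C) @[t --> \oo] --> prb P' (Y @^-1` C).
Proof.
move=> /(_ \1_C) XY.
have E d1 (T1 : measurableType d1) (P1 : probability T1 R) (Z : {RV P1 >-> qvec L}) :
    'E_P1[\1_C \o Z]%E = (prb P1 (Z @^-1` C))%:E.
  rewrite -prbE; last by rewrite -[X in measurable X]setTI; exact: measurable_funP.
  rewrite -expectation_indic //.
  by rewrite -[X in measurable X]setTI; exact: measurable_funP.
have : (exists c : R, forall q, `|\1_C q : R| <= c).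
  by exists 1 => q; rewrite indicE; case: (q \in C); rewrite ?normr1 ?normr0.
move=> /XY; rewrite E; under eq_fun do rewrite E.
by move=> /fine_cvg.
Qed.

Section Stationary.
Context (R : realType) (L : nat) (Amax Smax : nat).
Context (d : measure_display) (T : measurableType d).
Variables (P : probability T R) (S : 'I_L -> nat -> {RV P >-> nat}).
Variables (AS : nat -> {RV P >-> nat}) (A Q : nat -> {RV P >-> qvec L}).
Hypotheses (service : service_process S Smax)
  (routing : routing_system S AS A Q Amax) (JSQ : jsq S AS A Q).
Context (d' : measure_display) (T' : measurableType d').
Variables (P' : probability T' R) (Y : {RV P' >-> qvec L}).
Hypothesis QY : cvg_in_distribution Q Y.

Local Notation slot := ('I_Amax.+1 * {ffun 'I_L -> 'I_Smax.+1})%type.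
Local Notation weight := (slot_weight S AS (Amax := Amax) (Smax := Smax)).

(** Both sides are the limit of the probability that [Q t.+1] lies in [C]: once as a shifted
    sequence, once through the one-step formula. *)
Lemma stationary_law C : prb P' (Y @^-1` C) =
  next_law Amax Smax S AS (fun D => prb P' (Y @^-1` D)) C.
Proof.
have lim1 : prb P (Q t.+1 @^-1` C) @[t --> \oo] --> prb P' (Y @^-1` C).
  have := @cvg_in_distribution_prb _ _ _ _ _ _ _ _ _ _ C QY.
  by rewrite -(cvg_shiftS (fun t => prb P (Q t @^-1` C))).
have lim2 : prb P (Q t.+1 @^-1` C) @[t --> \oo] -->
    next_law Amax Smax S AS (fun D => prb P' (Y @^-1` D)) C.
  under eq_fun do rewrite (prb_queue_step service routing JSQ).
  rewrite /next_law; apply: cvgn_sum => M; apply: cvgn_sum => z; apply: cvgn_sum => l.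
  by apply: cvgMl_tmp; apply: cvgMl_tmp; exact: cvg_in_distribution_prb.
exact: cvg_unique lim1 lim2.
Qed.

(** The transition kernel acting on functions, dual to [next_law]. *)
Definition next_mean (f : qvec L -> R) (q : qvec L) : R :=
  \sum_(l in shortest q) #|shortest q|%:R^-1 * \sum_z weight z * f (step q l z).

Lemma next_mean_ge0 (f : qvec L -> R) q : (forall p, 0 <= f p) -> 0 <= next_mean f q.
Proof.
move=> f0; apply: sumr_ge0 => l _; rewrite mulr_ge0 ?invr_ge0 ?ler0n //.
by apply: sumr_ge0 => z _; rewrite mulr_ge0 // (slot_weight_ge0 service routing).
Qed.

(** Convergence in distribution tests bounded functions only. Unbounded [f] are reached through the
    invariant law, read as a mixture over the set of shortest queues, the slot and the chosen
    queue. *)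
Lemma integral_next_mean (f : qvec L -> R) : (forall q, 0 <= f q) ->
  (\int[P']_w (f (Y w))%:E = \int[P']_w (next_mean f (Y w))%:E)%E.
Proof.
move=> f0.
have w0 z : 0 <= weight z := slot_weight_ge0 service routing z.
pose I : finType := ({set 'I_L} * slot * 'I_L)%type.
pose c (i : I) : R :=
  if i.2 \in i.1.1 then #|i.1.1|%:R^-1 * weight i.1.2 else 0.
pose D (i : I) : set (qvec L) := [set q | shortest q = i.1.1].
pose h (i : I) (q : qvec L) := step q i.2 i.1.2.
have c0 i : 0 <= c i by rewrite /c; case: ifP => // _; rewrite mulr_ge0 ?invr_ge0 ?ler0n.
have sumI (F : I -> R) : \sum_i F i =
    \sum_(M : {set 'I_L}) \sum_(z : slot) \sum_(l < L) F (M, z, l).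
  rewrite pair_big /= pair_big /=; apply: eq_bigr => -[[M z] l] _ //.
have mixture C : measurable C -> distribution P' Y C =
    (\sum_i (c i)%:E * distribution P' Y (D i `&` h i @^-1` C))%E.
  move=> _; have mY B : measurable (Y @^-1` B).
    by rewrite -[X in measurable X]setTI; exact: measurable_funP.
  transitivity (prb P' (Y @^-1` C))%:E; first exact: prbE.
  rewrite stationary_law /next_law.
  transitivity (\sum_i c i * prb P' (Y @^-1` (D i `&` h i @^-1` C)))%:E.
    congr EFin; rewrite sumI; apply: eq_bigr => M _; apply: eq_bigr => z _.
    rewrite big_mkcond /=; apply: eq_bigr => l _; rewrite /c /=.
    by case: ifP => _; rewrite ?mul0r // mulrA.
  rewrite -sumEFin; apply: eq_bigr => i _; rewrite EFinM; congr (_ * _)%E.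
  by apply/esym; exact: prbE.
have f0' q : (0 <= (f q)%:E)%E by rewrite lee_fin.
have mix := @ge0_integral_mixture _ _ _ (distribution P' Y) _ c D h c0
  (fun=> Logic.I) (fun _ _ _ _ => Logic.I) mixture (EFin \o f) (fun _ _ _ => Logic.I) f0'.
rewrite -(@ge0_integral_distribution _ _ _ _ _ P' Y (EFin \o f)) // mix.
have n0 q : (0 <= (next_mean f q)%:E)%E by rewrite lee_fin next_mean_ge0.
rewrite -(@ge0_integral_distribution _ _ _ _ _ P' Y (EFin \o next_mean f)) //.
have nE q : (EFin \o next_mean f) q =
    (\sum_i (c i)%:E * ((fun q => (f (h i q))%:E) \_ (D i)) q)%E.
  transitivity (\sum_i c i * (f (h i q) * \1_(D i) q))%:E; last first.
    rewrite -sumEFin; apply: eq_bigr => i _; rewrite EFinM patchE indicE.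
    by case: ifP => _; rewrite ?mulr1 ?mulr0.
  (* Only the actual set of shortest queues contributes at [q]. *)
  rewrite sumI (bigD1 (shortest q)) //= [X in _ + X]big1 => [|M MQ].
    rewrite addr0 /next_mean /= exchange_big /= big_mkcond /=; congr EFin.
    apply: eq_bigr => l _; rewrite /c /=; case: ifP => _; last first.
      by rewrite big1 // => z _; rewrite mul0r.
    rewrite mulr_sumr; apply: eq_bigr => z _.
    by rewrite indicE mem_set // mulr1 mulrA.
  rewrite big1 // => z _; rewrite big1 // => l _; rewrite indicE memNset ?mulr0 //.
  by rewrite /D /=; apply/eqP; rewrite eq_sym.
under [RHS]eq_integral do rewrite nE.
have m0 i : forall q, (0 <= ((fun q => (f (h i q))%:E) \_ (D i)) q)%E.
  by move=> q; rewrite patchE; case: ifP => // _; rewrite lee_fin.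
rewrite ge0_integral_sum //; last by move=> i q _; rewrite mule_ge0 ?lee_fin.
by apply: eq_bigr => i _; rewrite ge0_integralZl ?lee_fin // -integral_mkcond.
Qed.

End Stationary.

(** * Moments of the steady state *)

Lemma exprn_sum_le (R : realFieldType) (L n : nat) (x : 'I_L -> R) : (0 < L)%N ->
  (forall l, 0 <= x l) ->
  (\sum_(l < L) x l) ^+ n <= L%:R ^+ n * \sum_(l < L) x l ^+ n.
Proof.
move=> L_gt0 x0.
pose l0 : 'I_L := Ordinal L_gt0.
(* Every term is compared with the largest one, whose power occurs on the right. *)
have [m _ xm] := @Order.TotalTheory.arg_maxP _ _ 'I_L l0 predT x isT.
apply: (@le_trans _ _ ((L%:R * x m) ^+ n)).
  rewrite lerXn2r ?nnegrE ?mulr_ge0 ?ler0n ?sumr_ge0 //.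
  rewrite mulr_natl -[X in _ *+ X]card_ord -sumr_const.
  by apply: ler_sum => l _; exact: xm.
rewrite exprMn ler_wpM2l ?exprn_ge0 ?ler0n // (bigD1 m) //= lerDl.
by apply: sumr_ge0 => l _; exact: exprn_ge0.
Qed.

Lemma shortest_neq0 (L : nat) (q : qvec L) : (0 < L)%N -> shortest q != finset.set0.
Proof.
move=> L_gt0; apply/set0Pn.
have [l _ ql] := @arg_minnP 'I_L (Ordinal L_gt0) predT (qval q) isT.
by exists l; rewrite inE; apply/forallP => m; exact: ql.
Qed.

Section SteadyMoments.
Context (R : realType) (L : nat) (Amax Smax : nat).
Hypothesis L_gt0 : (0 < L)%N.
Context (d : measure_display) (T : measurableType d).
Variables (P : probability T R) (S : 'I_L -> nat -> {RV P >-> nat}).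
Variables (AS : nat -> {RV P >-> nat}) (A Q : nat -> {RV P >-> qvec L}).
Hypotheses (service : service_process S Smax)
  (routing : routing_system S AS A Q Amax) (JSQ : jsq S AS A Q).
Context (d' : measure_display) (T' : measurableType d').
Variables (P' : probability T' R) (Y : {RV P' >-> qvec L}).
Hypotheses (QY : cvg_in_distribution Q Y) (momY : finite_moments Y).

Local Notation slot := ('I_Amax.+1 * {ffun 'I_L -> 'I_Smax.+1})%type.
Local Notation weight := (slot_weight S AS (Amax := Amax) (Smax := Smax)).

Lemma mu_min_le l : mu_min S <= mu S l.
Proof.
apply: ge_inf; last by exists l.
exists 0 => _ [m _ <-]; rewrite -(sum_slot_service service routing).
by apply: sumr_ge0 => z _; rewrite mulr_ge0 ?ler0n // (slot_weight_ge0 service routing).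
Qed.

Lemma measurable_qvec_comp (g : qvec L -> \bar R) :
  measurable_fun [set: T'] (fun w => g (Y w)).
Proof.
have mg : measurable_fun [set: qvec L] g by [].
exact: (measurableT_comp mg (measurable_funPT Y)).
Qed.

(** Reduces to moments of order [2 * k] of single queues. Finiteness is what permits the
    cancellation in [steady_moment]. *)
Lemma perpsq_moment (k : nat) : (\int[P']_w (perpsq R (Y w) ^+ k)%:E < +oo)%E.
Proof.
apply: (@le_lt_trans _ _
  (\int[P']_w (\sum_(l < L) (L%:R ^+ k)%:E * ((qval (Y w) l)%:R ^+ (2 * k))%:E))%E).
  apply: ge0_le_integral => //.
  - by move=> w _; rewrite lee_fin exprn_ge0 // perpsq_ge0.
  - exact: (measurable_qvec_comp (fun q => (perpsq R q ^+ k)%:E)).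
  - exact: (measurable_qvec_comp
      (fun q => (\sum_(l < L) (L%:R ^+ k)%:E * ((qval q l)%:R ^+ (2 * k))%:E)%E)).
  move=> w _; under eq_bigr do rewrite -EFinM.
  rewrite sumEFin -mulr_sumr lee_fin.
  apply: (@le_trans _ _ ((\sum_(l < L) (qval (Y w) l)%:R ^+ 2) ^+ k)).
    apply: lerXn2r; rewrite ?nnegrE ?perpsq_ge0 ?perpsq_le_sum_sqr //.
    by apply: sumr_ge0 => l _; exact: sqr_ge0.
  apply: le_trans (exprn_sum_le k L_gt0 _) _ => [l|]; first exact: sqr_ge0.
  by under eq_bigr do rewrite -exprM.
rewrite ge0_integral_sum //.
- apply: lte_sum_pinfty => l _; rewrite ge0_integralZl //.
  + apply: lte_mul_pinfty; rewrite ?lee_fin ?exprn_ge0 ?ler0n //.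
    by have := momY l (2 * k); rewrite expectation.unlock.
  + exact: (measurable_qvec_comp (fun q => ((qval q l)%:R ^+ (2 * k))%:E)).
- move=> l; exact: (measurable_qvec_comp
    (fun q => ((L%:R ^+ k)%:E * ((qval q l)%:R ^+ (2 * k))%:E)%E)).
Qed.

(** The drift inequality is averaged over tie-breaks and integrated in the steady state. By
    invariance the integral of [V] appears on both sides, and being finite it cancels. *)
Lemma steady_moment (delta C : R) (k : nat) : 0 <= C -> 0 < delta ->
  (forall q l, l \in shortest q ->
      \sum_z weight z * perpsq R (step q l z) ^+ k.+1 +
        delta * norm2 (perp R q) ^+ (2 * k).+1 <= perpsq R q ^+ k.+1 + C) ->
  (\int[P']_w (norm2 (perp R (Y w)) ^+ (2 * k).+1)%:E <= (C / delta)%:E)%E.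
Proof.
move=> C0 d0 drift.
pose V (q : qvec L) := perpsq R q ^+ k.+1.
pose W (q : qvec L) := norm2 (perp R q) ^+ (2 * k).+1.
have V0 q : 0 <= V q by rewrite exprn_ge0 // perpsq_ge0.
have W0 q : 0 <= W q by rewrite exprn_ge0 // norm2_ge0.
have nV0 q := next_mean_ge0 service routing q V0.
have nextV q : next_mean Amax Smax S AS V q + delta * W q <= V q + C.
  have s0 : (#|shortest q|%:R : R) != 0.
    by rewrite pnatr_eq0 -lt0n card_gt0 shortest_neq0.
  have avg (x : R) : x = \sum_(l in shortest q) #|shortest q|%:R^-1 * x.
    by rewrite sumr_const -[RHS]mulr_natl mulrA mulfV // mul1r.
  rewrite [X in _ + X]avg [leRHS]avg /next_mean -big_split /=.
  apply: ler_sum => l lq; rewrite -mulrDr ler_wpM2l ?invr_ge0 ?ler0n //.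
  exact: drift.
have := integral_next_mean service routing JSQ QY V0.
have fV := perpsq_moment k.+1.
set iV := (\int[P']_w (V (Y w))%:E)%E => e.
have iVfin : iV \is a fin_num.
  by rewrite ge0_fin_numE //; apply: integral_ge0 => w _; rewrite lee_fin.
have : (iV + delta%:E * \int[P']_w (W (Y w))%:E <= iV + C%:E)%E.
  (* Only the left [iV] is turned into the integral of [next_mean]. *)
  rewrite {1}e -ge0_integralZl //; last 3 first.
  - exact: (measurable_qvec_comp (fun q => (W q)%:E)).
  - by move=> w _; rewrite lee_fin.
  - by rewrite lee_fin ltW.
  rewrite -ge0_integralD //; last 4 first.
  - by move=> w _; rewrite lee_fin.
  - exact: (measurable_qvec_comp (fun q => (next_mean Amax Smax S AS V q)%:E)).
  - by move=> w _; rewrite mule_ge0 ?lee_fin ?(ltW d0).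
  - exact: (measurable_qvec_comp (fun q => (delta%:E * (W q)%:E)%E)).
  have -> : C%:E = (\int[P']_w (cst C%:E) w)%E.
    by rewrite -[LHS](expectation_cst P' C) expectation.unlock.
  rewrite /iV -ge0_integralD //; last 2 first.
  - by move=> w _; rewrite lee_fin.
  - exact: (measurable_qvec_comp (fun q => (V q)%:E)).
  apply: ge0_le_integral => //.
  - by move=> w _; rewrite adde_ge0 ?mule_ge0 ?lee_fin ?(ltW d0).
  - exact: (measurable_qvec_comp
      (fun q => ((next_mean Amax Smax S AS V q)%:E + delta%:E * (W q)%:E)%E)).
  - exact: (measurable_qvec_comp (fun q => ((V q)%:E + C%:E)%E)).
  by move=> w _; rewrite -EFinM -!EFinD lee_fin.
rewrite leeD2lE // mulrC EFinM => h.
by rewrite lee_pdivlMl.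
Qed.

(** For [x >= 0], [x ^+ r] is at most 1 if [x <= 1] and at most [x ^+ (2 * r).+1] otherwise, so the
    odd moments control all others. *)
Lemma steady_norm_moment (delta C : R) (r : nat) : 0 <= C -> 0 < delta ->
  (forall q l, l \in shortest q ->
      \sum_z weight z * perpsq R (step q l z) ^+ r.+1 +
        delta * norm2 (perp R q) ^+ (2 * r).+1 <= perpsq R q ^+ r.+1 + C) ->
  ('E_P'[(fun w => norm2 (perp R (Y w)) ^+ r)%R] <= (1 + C / delta)%:E)%E.
Proof.
move=> C0 d0 drift; rewrite expectation.unlock EFinD.
apply: le_trans (leeD (lexx _) (steady_moment C0 d0 drift)).
have -> : 1%:E = (\int[P']_w (cst 1%:E) w)%E.
  by rewrite -[LHS](expectation_cst P' 1) expectation.unlock.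
rewrite -ge0_integralD //; last 2 first.
- by move=> w _; rewrite lee_fin exprn_ge0 // norm2_ge0.
- exact: (measurable_qvec_comp (fun q => (norm2 (perp R q) ^+ (2 * r).+1)%:E)).
apply: ge0_le_integral => //.
- by move=> w _; rewrite lee_fin exprn_ge0 // norm2_ge0.
- exact: (measurable_qvec_comp (fun q => (norm2 (perp R q) ^+ r)%:E)).
- exact: (measurable_qvec_comp
    (fun q => (1%:E + (norm2 (perp R q) ^+ (2 * r).+1)%:E)%E)).
move=> w _; rewrite -EFinD lee_fin; set x := norm2 _.
have x0 : 0 <= x := norm2_ge0 R (Y w).
have [x1|x1] := leP x 1.
  by rewrite -[leLHS]addr0 lerD ?exprn_ge0 // exprn_ile1.
rewrite -[leLHS]add0r lerD // ler_weXn2l ?(ltW x1) //.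
by rewrite mul2n -addnn leqW // leq_addr.
Qed.

End SteadyMoments.

(** * Moment bounds uniform in [eps] *)

Theorem proposition1 (R : realType) (L : nat) (L_gt0 : (0 < L)%N)
  (Amax Smax : nat)
  (d : measure_display) (T : measurableType d) (P : probability T R)
  (d' : measure_display) (T' : measurableType d') (P' : probability T' R)
  (S : 'I_L -> nat -> {RV P >-> nat})
  (E : set R)
  (AS : R -> nat -> {RV P >-> nat})
  (A Q : R -> nat -> {RV P >-> qvec L})
  (Qbar : R -> {RV P' >-> qvec L})
  (service : service_process S Smax)
  (mu_min_gt0 : 0 < mu_min S)
  (E_gt0 : forall eps, E eps -> 0 < eps)
  (routing : forall eps, E eps ->
     routing_system S (AS eps) (A eps) (Q eps) Amax)
  (arrival_mean : forall eps, E eps ->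
     'E_P[fun w => (AS eps 1%N w)%:R]%E = (mu_sum S - eps)%:E)
  (JSQ : forall eps, E eps -> jsq S (AS eps) (A eps) (Q eps))
  (steady : forall eps, E eps -> cvg_in_distribution (Q eps) (Qbar eps))
  (moments : forall eps, E eps -> finite_moments (Qbar eps)) :
  forall delta : R, 0 < delta < mu_min S ->
  exists N : nat -> R,
    forall eps, E eps -> 0 < eps < (mu_min S - delta) * L%:R ->
    forall r : nat, (0 < r)%N ->
      ('E_P'[(fun w => norm2 (perp R (Qbar eps w)) ^+ r)%R] <= (N r)%:E)%E.
Proof.
move=> delta /andP[d0 _].
pose bound r := pow_mean_drift Amax Smax L_gt0 r d0.
exists (fun r => 1 + s2val (bound r) / delta) => eps Eeps /andP[_ eps_lt] r _.
have L0 : 0 < L%:R :> R by rewrite ltr0n.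
have rt := routing _ Eeps.
apply: (steady_norm_moment L_gt0 service rt (JSQ _ Eeps) (steady _ Eeps)
  (moments _ Eeps)) => //; first exact: (s2valP (bound r)).
have hC := s2valP' (bound r).
apply: (hC (slot_weight S (AS eps) (Amax := Amax) (Smax := Smax)) (mu S) eps).
- by move=> z; exact: slot_weight_ge0 service rt z.
- exact: sum_slot_weight service rt.
- by apply: EFin_inj; rewrite (sum_slot_arrival service rt) arrival_mean.
- exact: sum_slot_service service rt.
(* The upper bound on [eps] gives [eps / L%:R <= mu_min S - delta]. *)
- move=> l; rewrite lerBrDr -lerBrDl.
  apply: (@le_trans _ _ (mu_min S - delta)).
    by rewrite ler_pdivrMr // ltW.
  by rewrite lerB // (mu_min_le service rt).
Qed.
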